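(* Let $({\cal F},\tau)$ be an oriented Fano plane, let $\epsilon^\tau$ be its canonical composition factor, and let $g\in\mathrm{Aut}({\cal F})$. Then the function $\delta^\ast(g,\cdot):{\cal F}^\ast\to S_2$ (computed with $\epsilon=\epsilon^\tau$) is one of the following eight functions: the constant function $1$, or, for some point $P\in{\cal F}$, the function $D\mapsto 1$ if $P\in D$ and $D\mapsto-1$ if $P\notin D$.
   Context: A Fano plane ${\cal F}$ is a projective plane with seven points and seven lines; ${\cal F}^\ast$ is its set of lines; $\mathrm{Aut}({\cal F})$ is the group of bijections of ${\cal F}$ sending lines to lines. $S_2=\{1,-1\}$. An orientation of ${\cal F}$ is an element $\tau\in\mathrm{Aut}({\cal F})$ of order seven. The canonical composition factor $\epsilon^\tau$ is defined on ordered pairs of distinct points: fix $P_0\in{\cal F}$, write $R=\tau^i(P_0)$, $S=\tau^j(P_0)$; then $\epsilon^\tau_{RS}=1$ if $j-i\equiv1,2,4 \pmod 7$ and $\epsilon^\tau_{RS}=-1$ if $j-i\equiv 3,5,6\pmod 7$ (this is independent of $P_0$ and is a composition factor, i.e. the corresponding algebra on $\mathbb F 1\oplus\bigoplus_P\mathbb F e_P$ with $e_Pe_Q=\epsilon_{PQ}e_{P+Q}$, $e_P^2=-1$, $1$ a unit, is a composition algebra for the sum-of-squares norm). For a composition factor $\epsilon$, $g\in\mathrm{Aut}({\cal F})$ and a line $D$, $\delta^\ast(g,D)=\epsilon_{PQ}\,\epsilon_{g(P)\,g(Q)}$ for any two distinct points $P,Q\in D$ (this does not depend on the choice of $P,Q$).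 *)

(* Defs.v *)
From HB Require Import structures.
From mathcomp Require Import all_boot all_order all_algebra all_fingroup.
From mathcomp Require Import zify.

Set Implicit Arguments.
Unset Strict Implicit.
Unset Printing Implicit Defensive.

Import GRing.Theory.

Local Open Scope ring_scope.

Definition projective_plane (T : finType) (L : {set {set T}}) : Prop :=
  [/\ forall P Q : T, P != Q ->
        exists! D : {set T}, [/\ D \in L, P \in D & Q \in D],
      forall D E : {set T}, D \in L -> E \in L -> D != E ->
        exists! P : T, P \in D /\ P \in E
    & exists s : seq T, [/\ size s = 4%N, uniq s
        & forall D : {set T}, D \in L -> (count (fun P => P \in D) s <= 2)%N]].

Record fanoPlane := FanoPlane {
  fpoint :> finType;
  flines : {set {set fpoint}};
  fano_plane : projective_plane flines;
  card_fpoint : #|fpoint| = 7%N;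
  card_flines : #|flines| = 7%N }.

(* The set F^* of lines, as a type. *)
Definition fline (F : fanoPlane) := {D : {set F} | D \in flines F}.

Definition fano_aut (F : fanoPlane) : {set {perm F}} :=
  [set g : {perm F} | [forall D in flines F, (g @: D) \in flines F]].

Definition orientation (F : fanoPlane) (tau : {perm F}) : Prop :=
  tau \in fano_aut F /\ #[tau]%g = 7%N.

(* The value 0 is only reached on multiples of 7, that is, for R = S, outside
   the domain of a composition factor. *)
Definition sign_mod7 (d : int) : int :=
  if (d %% 7)%Z \in [:: 1; 2; 4] then 1
  else if (d %% 7)%Z \in [:: 3; 5; 6] then -1 else 0.

(* findex tau P0 R is the least i such that R = tau^i(P0); canonical_factorE
   below shows that neither P0 nor the choice of exponents matters. *)
Definition canonical_factor (F : fanoPlane) (tau : {perm F}) (P0 : F)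
    (R S : F) : int :=
  sign_mod7 ((findex tau P0 S)%:Z - (findex tau P0 R)%:Z).

(* delta^*(g, D) is computed on some pair of distinct points of D; delta_starE
   below shows that for a canonical factor every pair gives the same value. *)
Definition delta_star (F : fanoPlane) (eps : F -> F -> int) (g : {perm F})
    (D : fline F) : int :=
  if [pick u : F * F | [&& u.1 != u.2, u.1 \in val D & u.2 \in val D]]
    is Some (P, Q) then eps P Q * eps (g P) (g Q) else 0.

Lemma group_set_fano_aut (F : fanoPlane) : group_set (fano_aut F).
Proof.
apply/group_setP; split=> [|g h].
  rewrite inE; apply/forall_inP => D DL.
  by rewrite (eq_imset _ (@perm1 _)) imset_id.
rewrite !inE => /forall_inP gL /forall_inP hL; apply/forall_inP => D DL.
by rewrite (eq_imset _ (permM g h)) imset_comp; apply/hL/gL.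
Qed.

Canonical fano_aut_group (F : fanoPlane) : {group {perm F}} :=
  Group (group_set_fano_aut F).

Section Orientation.

Variables (F : fanoPlane) (tau : {perm F}).
Hypothesis tauO : orientation tau.

Lemma line_join (P Q : F) (D E : {set F}) : P != Q ->
  D \in flines F -> E \in flines F ->
  P \in D -> Q \in D -> P \in E -> Q \in E -> D = E.
Proof.
move=> PQ DL EL PD QD PE QE.
have [join _ _] := fano_plane F.
by have [X [_ uX]] := join P Q PQ; rewrite -(uX D) // -(uX E).
Qed.

Lemma line_neq_setT (D : {set F}) : D \in flines F -> D != setT.
Proof.
move=> DL; apply/eqP => DT.
have [_ _ [s [s4 _ /(_ D DL)]]] := fano_plane F.
by rewrite DT (eq_count (a2 := predT)) ?count_predT ?s4 // => x; rewrite inE.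
Qed.

Lemma aut_line (g : {perm F}) (D : {set F}) :
  g \in fano_aut F -> D \in flines F -> g @: D \in flines F.
Proof. by rewrite inE => /forall_inP; apply. Qed.

Lemma porbit_orientation (P : F) : porbit tau P = setT.
Proof.
have [_ tau7] := tauO.
have orb x : (#|porbit tau x| == 1)%N || (#|porbit tau x| == 7)%N.
  have := dvdn_orbit 'P <[tau]> x.
  rewrite -porbitE -orderE tau7 => h.
  by have /primeP[_ /(_ _ h)] : prime 7 by [].
have full x : tau x != x -> porbit tau x = setT.
  move=> tx; apply/eqP; rewrite eqEcard subsetT cardsT card_fpoint.
  case/orP: (orb x) => [/eqP /eqP /cards1P [y xy]|/eqP -> //].
  have := porbit_id tau x; have := mem_porbit tau 1 x.
  by rewrite xy !inE expg1 => /eqP ty /eqP xx; rewrite ty -xx eqxx in tx.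
have [x tx|fx] := pickP (fun x => tau x != x).
  have Px : P \in porbit tau x by rewrite full.
  by rewrite -(full x tx); apply/eqP; rewrite eq_porbit_mem.
have t1 : tau = 1%g by apply/permP => x; rewrite perm1; apply/eqP/negPn; rewrite fx.
by rewrite t1 order1 in tau7.
Qed.

Lemma iter_orientation (P Q : F) : exists i, Q = iter i tau P.
Proof.
have : Q \in porbit tau P by rewrite porbit_orientation.
by case/porbitP => i ->; exists i; rewrite permX.
Qed.

Lemma order_orientation (P : F) : fingraph.order tau P = 7%N.
Proof.
rewrite -(card_fpoint F) /fingraph.order; apply: eq_card => Q.
by have [i ->] := iter_orientation P Q; rewrite !inE fconnect_iter.
Qed.

Lemma iter_mod7 (P : F) i : iter (i %% 7) tau P = iter i tau P.
Proof.
have K k : iter (k * 7) tau P = P.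
  elim: k => // k IH.
  by rewrite mulSn iterD IH -(order_orientation P) iter_order //; exact: perm_inj.
by rewrite [in RHS](divn_eq i 7) addnC iterD K.
Qed.

Lemma findex_orientation (P : F) i : findex tau P (iter i tau P) = (i %% 7)%N.
Proof. by rewrite -iter_mod7 findex_iter // order_orientation ltn_mod. Qed.

Lemma canonical_factorE (P0 P : F) i j :
  canonical_factor tau P0 (iter i tau P) (iter j tau P) =
  sign_mod7 (j%:Z - i%:Z).
Proof.
have [k ->] := iter_orientation P0 P.
rewrite -!iterD /canonical_factor !findex_orientation /sign_mod7.
by have -> : ((((j + k) %% 7)%N%:Z - ((i + k) %% 7)%N%:Z) %% 7)%Z
  = ((j%:Z - i%:Z) %% 7)%Z by lia.
Qed.

Lemma canonical_factor_base (P0 P1 R S : F) :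
  canonical_factor tau P0 R S = canonical_factor tau P1 R S.
Proof.
have [i ->] := iter_orientation P0 R; have [j ->] := iter_orientation P0 S.
by rewrite !canonical_factorE.
Qed.

Lemma iter_line (D : {set F}) i : D \in flines F ->
  [set iter i tau P | P in D] \in flines F.
Proof.
move=> DL; elim: i => [|i IH]; first by rewrite imset_id.
have -> : [set iter i.+1 tau P | P in D] = tau @: [set iter i tau P | P in D].
  by rewrite -imset_comp.
by apply: aut_line IH; case: tauO.
Qed.

Lemma line_diff (P : F) (D : {set F}) i j k l : D \in flines F ->
  iter i tau P \in D -> iter j tau P \in D ->
  iter k tau P \in D -> iter l tau P \in D ->
  iter i tau P != iter j tau P ->
  (i < 7)%N -> (k < 7)%N -> i != k -> (j + k = i + l %[mod 7])%N -> False.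
Proof.
move=> DL iD jD kD lD ij i7 k7 ik e.
pose m := (k + (7 - i))%N.
have mi : iter m tau (iter i tau P) = iter k tau P.
  by rewrite -iterD -iter_mod7 -[RHS]iter_mod7; congr (iter _ _ _); lia.
have mj : iter m tau (iter j tau P) = iter l tau P.
  by rewrite -iterD -iter_mod7 -[RHS]iter_mod7; congr (iter _ _ _); lia.
have inj_m : injective (iter m tau).
  by elim: (m) => [|n IH] x y //= /perm_inj /IH.
have kl : iter k tau P != iter l tau P by rewrite -mi -mj (inj_eq inj_m).
have mD : [set iter m tau Q | Q in D] = D.
  apply: (line_join kl (iter_line m DL) DL) => //.
    by apply/imsetP; exists (iter i tau P).
  by apply/imsetP; exists (iter j tau P).
have step n Q : Q \in D -> iter (n * m) tau Q \in D.
  move=> QD; elim: n => // n IH; rewrite mulSn iterD -mD.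
  by apply/imsetP; exists (iter (n * m) tau Q).
have inv7 : exists n, (n * m = 1 %[mod 7])%N.
  have [] : [\/ m %% 7 = 1, m %% 7 = 2 | m %% 7 = 3]%N \/
            [\/ m %% 7 = 4, m %% 7 = 5 | m %% 7 = 6]%N.
    have : (m %% 7 != 0)%N by rewrite /m; lia.
    have := ltn_pmod m (isT : 0 < 7)%N.
    by case: (m %% 7)%N => [|[|[|[|[|[|[|]]]]]]] // _ _;
      (left + right); (constructor 1 + constructor 2 + constructor 3).
  - by case=> h; [exists 1%N | exists 4%N | exists 5%N]; rewrite -modnMmr h.
  - by case=> h; [exists 2%N | exists 3%N | exists 6%N]; rewrite -modnMmr h.
have [n n1] := inv7.
case/negP: (line_neq_setT DL); rewrite eqEsubset subsetT; apply/subsetP => Q _.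
have [t ->] := iter_orientation (iter i tau P) Q.
rewrite -iter_mod7.
have -> : (t %% 7 = (t * n * m) %% 7)%N.
  by rewrite -mulnA -modnMmr n1 modnMmr muln1.
by rewrite iter_mod7; apply: step.
Qed.

Lemma sign_cyclic :
  all (fun a => all (fun b => all (fun c =>
    [&& a != b, b != c, c != a,
        (b + b) %% 7 != (a + c) %% 7, (c + c) %% 7 != (b + a) %% 7 &
        (a + a) %% 7 != (c + b) %% 7]%N ==>
    (sign_mod7 (b%:Z - a%:Z) == sign_mod7 (c%:Z - b%:Z)))
  (iota 0 7)) (iota 0 7)) (iota 0 7).
Proof. by vm_compute. Qed.

Lemma canonical_factor_cyclic (P0 P Q R : F) (D : {set F}) :
  D \in flines F -> P \in D -> Q \in D -> R \in D ->
  P != Q -> Q != R -> R != P ->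
  canonical_factor tau P0 P Q = canonical_factor tau P0 Q R.
Proof.
move=> DL.
have ex S : exists2 i, (i < 7)%N & S = iter i tau P0.
  have [i ->] := iter_orientation P0 S.
  by exists (i %% 7)%N; rewrite ?ltn_mod ?iter_mod7.
have [a a7 ->] := ex P; have [b b7 ->] := ex Q; have [c c7 ->] := ex R.
move=> aD bD cD nab nbc nca; rewrite !canonical_factorE.
have in7 i : (i < 7)%N -> i \in iota 0 7 by rewrite mem_iota.
have ab : a != b by apply: contraNneq nab => ->.
have bc : b != c by apply: contraNneq nbc => ->.
have ca : c != a by apply: contraNneq nca => ->.
move/allP/(_ a (in7 a a7))/allP/(_ b (in7 b b7))/allP/(_ c (in7 c c7)): sign_cyclic.
move/implyP => h; apply/eqP/h; rewrite ab bc ca /=.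
apply/and3P; split; apply/negP => /eqP e.
- exact: (line_diff DL aD bD bD cD).
- exact: (line_diff DL bD cD cD aD).
- exact: (line_diff DL cD aD aD bD).
Qed.

Lemma canonical_factor_sym (P0 P Q : F) : P != Q ->
  canonical_factor tau P0 Q P = - canonical_factor tau P0 P Q
  /\ canonical_factor tau P0 P Q \in [:: 1; -1].
Proof.
have [i ->] := iter_orientation P0 P; have [j ->] := iter_orientation P0 Q.
move=> ij; rewrite !canonical_factorE /sign_mod7.
have nij : (i %% 7 != j %% 7)%N.
  by apply: contraNneq ij => e; rewrite -iter_mod7 e iter_mod7.
have h : (0 < ((j%:Z - i%:Z) %% 7)%Z < 7)%R by lia.
have -> : ((i%:Z - j%:Z) %% 7)%Z = 7 - ((j%:Z - i%:Z) %% 7)%Z by lia.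
by case: ((j%:Z - i%:Z) %% 7)%Z h => [[|[|[|[|[|[|[|]]]]]]]|].
Qed.

Lemma delta_starE (P0 : F) (g : {perm F}) (D : fline F) (P Q : F) :
  g \in fano_aut F -> P != Q -> P \in val D -> Q \in val D ->
  delta_star (canonical_factor tau P0) g D =
  canonical_factor tau P0 P Q * canonical_factor tau P0 (g P) (g Q).
Proof.
move=> gA; set e := canonical_factor tau P0.
pose f X Y := e X Y * e (g X) (g Y).
have DL := valP D; have gDL := aut_line gA DL.
have sym X Y : X != Y -> f X Y = f Y X.
  move=> XY; have gXY : g X != g Y by rewrite (inj_eq perm_inj).
  rewrite /f /e (canonical_factor_sym P0 XY).1 (canonical_factor_sym P0 gXY).1.
  by rewrite mulrNN.
have cyc X Y Z : X \in val D -> Y \in val D -> Z \in val D ->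
    X != Y -> Y != Z -> f X Y = f Y Z.
  move=> XD YD ZD XY YZ; have [->|ZX] := eqVneq Z X; first exact: sym.
  rewrite /f /e (canonical_factor_cyclic P0 DL XD YD ZD) //.
  rewrite (canonical_factor_cyclic P0 gDL (imset_f g XD) (imset_f g YD)
    (imset_f g ZD)) //; by rewrite (inj_eq perm_inj).
have indep X Y X' Y' : X \in val D -> Y \in val D -> X' \in val D ->
    Y' \in val D -> X != Y -> X' != Y' -> f X Y = f X' Y'.
  move=> XD YD X'D Y'D XY X'Y'.
  have [YX'|YX'] := eqVneq Y X'.
    by rewrite -YX' in X'Y' *; apply: cyc.
  by rewrite (cyc X Y X') // (cyc Y X' Y').
move=> PQ PD QD; rewrite /delta_star; case: pickP => [[X Y] /and3P[/= XY XD YD]|].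
  exact: indep.
by move/(_ (P, Q)); rewrite /= PQ PD QD.
Qed.

End Orientation.

(* Main.v *)
(** The eight functions are the characters of the dual of the vector space
    F_2^3 whose nonzero vectors are the points, so the theorem amounts to
    delta^* having product 1 over the three lines of every pencil.  Computed on
    the points of a line H not through the centre Q of the pencil, this product
    is the product over X in H of eps_{QX} eps_{gQ gX}.  In the exponents of tau
    every line is a translate of {0, 1, 3} or every line is one of {0, 1, 5},
    and the product over H of eps_{QX} is a sign depending on neither Q nor H.
    As gQ is not on gH either, the two signs cancel. *)

Require Import Defs.
From mathcomp Require Import all_boot all_order all_algebra all_fingroup.
From mathcomp Require Import zify.

Import GRing.Theory.

Set Implicit Arguments.
Unset Strict Implicit.

Local Open Scope ring_scope.

(** * Sign functions on the lines of a Fano plane *)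

Section FanoPlane.

Variable F : fanoPlane.

Lemma line_joinP (P Q : F) : P != Q ->
  exists D : fline F, P \in val D /\ Q \in val D.
Proof.
have [join _ _] := fano_plane F.
by move=> /join[D [[DL PD QD] _]]; exists (exist _ D DL).
Qed.

Lemma line_meet (D E : {set F}) : D \in flines F -> E \in flines F ->
  exists P, P \in D /\ P \in E.
Proof.
have [_ meet _] := fano_plane F.
move=> DL EL; have [<-|/(meet _ _ DL EL)[P [? _]]] := eqVneq D E;
  last by exists P.
(* The axioms do not say outright that a line has a point; one comes from meeting [D] with a second
   line. *)
have : (0 < #|flines F :\ D|)%N.
  by have := cardsD1 D (flines F); rewrite DL card_flines add1n => -[<-].
case/card_gt0P=> D'; rewrite !inE eq_sym => /andP[DD' D'L].
by have [P [[PD _] _]] := meet _ _ DL D'L DD'; exists P.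
Qed.

Lemma fline_join (P Q : F) (D E : fline F) : P != Q -> P \in val D ->
  Q \in val D -> P \in val E -> Q \in val E -> D = E.
Proof.
by move=> PQ *; apply: val_inj; apply: (line_join PQ) => //; apply: valP.
Qed.

Hypothesis card_line : forall D : {set F}, D \in flines F -> #|D| = 3%N.

(** If [s] takes the value -1 at [D], the point [P] sought lies off [D]: it is the common point of
    two lines of sign 1 that meet [D] in different points. *)
Lemma pencil_character (s : fline F -> int) :
  (forall D, s D = 1 \/ s D = -1) ->
  (forall (Q : F) (D E G : fline F), D != E -> D != G -> E != G ->
     Q \in val D -> Q \in val E -> Q \in val G -> s D * s E * s G = 1) ->
  s =1 (fun=> 1) \/ exists P : F, s =1 (fun D => if P \in val D then 1 else -1).
Proof.
move=> s1 spencil.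
have [D sD|all1] := pickP (fun D : fline F => s D != 1); last first.
  by left=> D; apply/eqP; rewrite -[_ == _]negbK all1.
have {}sD : s D = -1 by case: (s1 D) sD => ->.
have outside (X Y : {set F}) : X \in flines F -> Y \in flines F ->
    exists P, (P \notin X) && (P \notin Y).
  move=> XL YL; have : (0 < #|~: (X :|: Y)|)%N.
    rewrite cardsCs setCK card_fpoint subn_gt0.
    have [XY6 _] := leq_card_setU X Y; apply: leq_ltn_trans XY6 _.
    by rewrite !card_line.
  by case/card_gt0P=> P; rewrite !inE negb_or; exists P.
(* Of the two other lines through [A], if one has sign -1, the pencil relation with [D] gives the
   other sign 1. *)
have pos A : A \in val D -> exists a : fline F, A \in val a /\ s a = 1.
  move=> AD.
  have [X /andP[XD _]] := outside _ _ (valP D) (valP D).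
  have AX : A != X by apply: contraNneq XD => <-.
  have [E [AE XE]] := line_joinP AX.
  case: (s1 E) => sE; first by exists E.
  have [Y /andP[YD YE]] := outside _ _ (valP D) (valP E).
  have AY : A != Y by apply: contraNneq YD => <-.
  have [G [AG YG]] := line_joinP AY.
  exists G; split=> //.
  have DE : D != E by apply: contraNneq XD => ->.
  have DG : D != G by apply: contraNneq YD => ->.
  have EG : E != G by apply: contraNneq YE => ->.
  by have := spencil _ _ _ _ DE DG EG AD AE AG; rewrite sD sE mulrNN !mul1r.
have /card_gt1P[A [B [AD BD AB]]] : (1 < #|val D|)%N.
  by rewrite card_line //; apply: valP.
have [[a [Aa sa]] [b [Bb sb]]] := (pos _ AD, pos _ BD).
have ab : a != b.
  apply/eqP => eab; rewrite -eab in Bb.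
  by move: sa; rewrite (fline_join AB Aa Bb AD BD) sD.
have [P [Pa Pb]] := line_meet (valP a) (valP b).
have sP (E : fline F) : P \in val E -> s E = 1.
  move=> PE; have [->//|aE] := eqVneq E a; have [->//|bE] := eqVneq E b.
  rewrite eq_sym in aE; rewrite eq_sym in bE.
  by have := spencil _ _ _ _ ab aE bE Pa Pb PE; rewrite sa sb !mul1r.
right; exists P => E; case: ifPn => [/sP //|PE].
case: (s1 E) => // sE.
(* If [E] avoids [P] and has sign 1, then at [C] the lines [E], [D] and [PC] have signs 1, -1, 1,
   against the pencil relation. *)
have [C [CE CD]] := line_meet (valP E) (valP D).
have PC : P != C by apply: contraNneq PE => ->.
have [f [Pf Cf]] := line_joinP PC.
have sf := sP _ Pf.
have ED : E != D by apply: contra_eq_neq sE => ->; rewrite sD.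
have Ef : E != f by apply: contraNneq PE => ->.
have Df : D != f by apply: contra_eq_neq sf => <-; rewrite sD.
by have := spencil _ _ _ _ ED Ef Df CE CD Cf; rewrite sE sD sf.
Qed.

End FanoPlane.

(** * Lines as difference sets modulo 7 *)

Section OrientedFanoPlane.

Variables (F : fanoPlane) (tau : {perm F}).
Hypothesis tauO : orientation tau.

Lemma eq_iter_orientation (P : F) i j :
  (iter i tau P == iter j tau P) = (i == j %[mod 7])%N.
Proof.
apply/eqP/eqP=> [e|e]; last by rewrite -(iter_mod7 tauO) e iter_mod7.
by rewrite -!(findex_orientation tauO P) e.
Qed.

Lemma iter_ltn7 (P Q : F) : exists2 i, (i < 7)%N & Q = iter i tau P.
Proof.
have [i ->] := iter_orientation tauO P Q.
by exists (i %% 7)%N; rewrite ?ltn_mod ?iter_mod7.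
Qed.

(** A line meets its translate by the [d]-th power of [tau], so every difference of exponents occurs
    in it. *)
Lemma line_shift (D : {set F}) d : D \in flines F ->
  exists2 S, S \in D & iter d tau S \in D.
Proof.
move=> DL; have [_ [/imsetP[S SD ->]]] := line_meet (iter_line tauO d DL) DL.
by exists S.
Qed.

(** By [line_diff] a nonzero difference occurs only once. As 0 and 1 use up the difference 1, the
    exponents 2 and 6 are excluded; the difference 2 must occur, which then forces 3 or 5. *)
Lemma line_shape1 (D : {set F}) (S : F) : D \in flines F ->
  S \in D -> tau S \in D ->
  exists2 k, k \in [:: 3; 5]%N & D = [set S; tau S; iter k tau S].
Proof.
move=> DL A0 A1.
have diff i d k : iter i tau S \in D -> iter (i + d) tau S \in D ->
    iter k tau S \in D -> iter (k + d) tau S \in D ->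
    (i < 7)%N -> (k < 7)%N -> i != k -> (d %% 7 != 0)%N -> False.
  move=> hi hid hk hkd i7 k7 ik d0.
  apply: (line_diff tauO DL hi hid hk hkd _ i7 k7 ik); last by congr modn; lia.
  by rewrite eq_iter_orientation; lia.
have A7 i : iter (i + 7) tau S = iter i tau S.
  by apply/eqP; rewrite eq_iter_orientation modnDr.
have N2 : iter 2 tau S \notin D by apply/negP => h; apply: (diff 0 1 1)%N.
have N6 : iter 6 tau S \notin D.
  by apply/negP => h; apply: (diff 0 1 6)%N; rewrite // (A7 0%N).
have [k k35 Ak] : exists2 k, k \in [:: 3; 5]%N & iter k tau S \in D.
  have [X] := line_shift 2 DL; have [a a7 ->] := iter_ltn7 S X.
  rewrite -iterD addnC; case: a a7 => [|[|[|[|[|[|[|]]]]]]] // _ h2 h2'.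
  - by case/negP: N2.
  - by exists 3%N.
  - by case/negP: N2.
  - by exists 3%N.
  - by case/negP: N6.
  - by exists 5%N.
  - by case/negP: N6.
exists k => //; apply/setP => X; rewrite !inE.
have [i i7 ->] := iter_ltn7 S X.
rewrite (eq_iter_orientation S i 0) (eq_iter_orientation S i 1).
rewrite eq_iter_orientation.
move: k35 Ak; rewrite !inE => /orP[]/eqP-> Ak;
  case: i i7 => [|[|[|[|[|[|[|]]]]]]] // _;
  rewrite ?Ak ?A0 ?(negPf N2) ?(negPf N6) //;
  apply/negP => h.
- by apply: (diff 0 1 3)%N.
- by apply: (diff 1 2 3)%N.
- by apply: (diff 1 2 3)%N.
- by apply: (diff 0 1 4)%N.
Qed.

Lemma line_shape :
  exists2 k, k \in [:: 3; 5]%N & forall D : {set F}, D \in flines F ->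
    exists S, D = [set S; tau S; iter k tau S].
Proof.
have /card_gt0P[D0 D0L] : (0 < #|flines F|)%N by rewrite card_flines.
have [S0 S0D tS0D] := line_shift 1 D0L.
have [k k35 D0E] := line_shape1 D0L S0D tS0D.
exists k => // D DL; have [S SD tSD] := line_shift 1 DL.
exists S; have [m Sm] := iter_orientation tauO S0 S.
have tS : S != tau S by rewrite (eq_iter_orientation S 0 1).
have com i : iter i tau S = iter m tau (iter i tau S0).
  by rewrite Sm -!iterD addnC.
have comt : tau S = iter m tau (tau S0) := com 1%N.
(* The translate of [D0] taking [S0] to [S] shares [S] and [tau S] with [D], so the same [k] serves
   every line. *)
have <- : [set iter m tau P | P in D0] = [set S; tau S; iter k tau S].
  by rewrite D0E !imsetU !imset_set1 -com comt -Sm.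
apply: (line_join tS DL (iter_line tauO m D0L) SD tSD).
  by rewrite Sm imset_f.
by rewrite comt imset_f.
Qed.

Lemma card_line (D : {set F}) : D \in flines F -> #|D| = 3%N.
Proof.
have [k k35 shape] := line_shape => /shape[S ->].
rewrite -setUA !cardsU1 cards1 !inE.
rewrite (eq_iter_orientation S 0 1) (eq_iter_orientation S 0 k).
rewrite (eq_iter_orientation S 1 k).
by move: k35; rewrite !inE => /orP[]/eqP->.
Qed.

Lemma prod_antiflag (P0 : F) : exists2 c : int, c * c = 1 &
  forall (Q : F) (H : {set F}), H \in flines F -> Q \notin H ->
    \prod_(X in H) canonical_factor tau P0 Q X = c.
Proof.
have [k k35 shape] := line_shape.
(* With exponents counted from [S], only the four values of [q] off the line remain to be checked
   for each [k]. *)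
exists (if k == 3%N then 1 else -1); first by case: ifP.
move=> Q H HL; have [S HE] := shape _ HL.
have [q q7 ->] := iter_ltn7 S Q.
rewrite HE !inE (eq_iter_orientation S q 0) (eq_iter_orientation S q 1).
rewrite eq_iter_orientation => qH.
rewrite -setUA big_setU1 ?big_setU1 ?big_set1 /=; last 2 first.
- by rewrite !inE (eq_iter_orientation S 1 k); move: k35;
    rewrite !inE => /orP[]/eqP->.
- rewrite !inE (eq_iter_orientation S 0 1) (eq_iter_orientation S 0 k).
  by move: k35; rewrite !inE => /orP[]/eqP->.
rewrite (canonical_factorE tauO P0 S q 0) (canonical_factorE tauO P0 S q 1).
rewrite (canonical_factorE tauO).
by move: k35 qH; rewrite !inE => /orP[]/eqP->;
  case: q q7 => [|[|[|[|[|[|[|]]]]]]].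
Qed.

Lemma delta_pencil (P0 : F) (g : {perm F}) (Q : F) (D E G : fline F) :
  g \in fano_aut F -> D != E -> D != G -> E != G ->
  Q \in val D -> Q \in val E -> Q \in val G ->
  delta_star (canonical_factor tau P0) g D *
  delta_star (canonical_factor tau P0) g E *
  delta_star (canonical_factor tau P0) g G = 1.
Proof.
move=> gA DE DG EG QD QE QG.
have other (L : fline F) : exists2 X, X \in val L & Q != X.
  have /card_gt1P[X [Y [XL YL XY]]] : (1 < #|val L|)%N.
    by rewrite card_line //; apply: valP.
  by have [QX|QX] := eqVneq Q X; [exists Y; rewrite ?QX | exists X].
have [[X XD QX] [Y YE QY]] := (other D, other E).
have XY : X != Y.
  by apply: contraNneq DE => e; rewrite -e in YE;
    rewrite (fline_join QX QD XD QE YE).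
(* If [H] passed through [Q], both [D] and [E] would equal it. *)
have [H [XH YH]] := line_joinP XY.
have QH : Q \notin val H.
  apply: contraNN DE => QH.
  by rewrite (fline_join QX QD XD QH XH) (fline_join QY QE YE QH YH).
have [Z [ZH ZG]] := line_meet (valP H) (valP G).
have QZ : Q != Z by apply: contraNneq QH => ->.
have XZ : X != Z.
  by apply: contraNneq DG => e; rewrite -e in ZG;
    rewrite (fline_join QX QD XD QG ZG).
have YZ : Y != Z.
  by apply: contraNneq EG => e; rewrite -e in ZG;
    rewrite (fline_join QY QE YE QG ZG).
rewrite (delta_starE tauO P0 gA QX QD XD) (delta_starE tauO P0 gA QY QE YE).
rewrite (delta_starE tauO P0 gA QZ QG ZG).
have HE : val H = [set X; Y; Z].
  apply/eqP; rewrite eq_sym eqEcard (card_line (valP H)) -setUA.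
  rewrite !cardsU1 cards1 !inE.
  rewrite (negPf XY) (negPf XZ) (negPf YZ) /= andbT.
  by apply/subsetP => W; rewrite !inE => /or3P[] /eqP->.
pose e := canonical_factor tau P0.
transitivity (\prod_(W in val H) (e Q W * e (g Q) (g W))).
  rewrite HE -setUA !big_setU1 ?big_set1 ?inE ?negb_or ?XY ?XZ ?YZ //=.
  by rewrite -mulrA.
have [c cc prodc] := prod_antiflag P0.
(* Reindexed by [g], the second factor is a product over the line [g @: val H], which avoids [g Q];
   both factors are [c]. *)
rewrite big_split /= -(big_imset (e (g Q))) /=;
  last by move=> ? ? _ _ /perm_inj.
rewrite !prodc ?cc ?(valP H) ?aut_line ?(valP H) //.
by rewrite mem_imset //; apply: perm_inj.
Qed.

End OrientedFanoPlane.

Theorem theorem2p31 (F : fanoPlane) (tau : {perm F}) (P0 : F) (g : {perm F})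
    (tauO : orientation tau) (gA : g \in fano_aut F) :
  delta_star (canonical_factor tau P0) g =1 (fun D => 1) \/
  exists P : F,
    delta_star (canonical_factor tau P0) g =1
      (fun D => if P \in val D then 1 else -1).
Proof.
apply: pencil_character => [D DL|D|Q D E G]; last exact: delta_pencil.
  exact: (card_line tauO).
(* Two distinct points on [D] rule out the default value 0 of [delta_star]. *)
have /card_gt1P[P [Q [PD QD PQ]]] : (1 < #|val D|)%N.
  by rewrite (card_line tauO) //; apply: valP.
rewrite (delta_starE tauO P0 gA PQ PD QD).
have gPQ : g P != g Q by rewrite (inj_eq perm_inj).
have := (canonical_factor_sym tauO P0 PQ).2.
have := (canonical_factor_sym tauO P0 gPQ).2.
by rewrite !inE => /orP[]/eqP-> /orP[]/eqP->; [left|right|right|left].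
Qed.
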